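(* Let $\boldsymbol{\gamma}_7$ be the following real linear combination of $46$ connected simple graphs, each on the vertex set $\{1,\dots,8\}$ with $14$ edges. Each term is given by its list of edges (an entry $ij$ denotes the edge joining vertices $i$ and $j$), and the edges of each term are ordered lexicographically, i.e. in the order listed, as $I\wedge II\wedge\cdots\wedge XIV$; the coefficient follows the colon. 1. 16 17 18 23 25 28 34 38 46 48 57 58 68 78 : $1$ 2. 12 14 18 23 27 35 37 46 48 57 58 67 68 78 : $-21/8$ 3. 13 14 18 23 25 28 37 46 48 56 57 67 68 78 : $-77/4$ 4. 12 13 15 24 27 35 36 46 48 57 58 67 68 78 : $-35/8$ 5. 12 13 18 24 26 37 38 46 47 56 57 58 68 78 : $49/8$ 6. 14 17 18 23 25 26 35 37 46 48 56 58 67 78 : $77/8$ 7. 12 13 18 26 27 35 38 45 46 47 56 57 68 78 : $-105/8$ 8. 12 14 18 23 27 36 38 46 48 56 57 58 67 78 : $7/8$ 9. 12 14 15 23 27 35 36 46 48 57 58 67 68 78 : $35/8$ 10. 12 13 14 27 28 36 38 46 47 56 57 58 68 78 : $-49/8$ 11. 12 13 18 25 27 34 36 47 48 56 58 67 68 78 : $35/4$ 12. 12 13 14 25 26 36 38 45 47 57 58 67 68 78 : $-119/16$ 13. 12 13 15 24 28 36 38 47 48 56 57 67 68 78 : $49/8$ 14. 12 13 14 23 28 37 46 48 56 57 58 67 68 78 : $77/4$ 15. 12 15 17 25 26 35 36 38 45 47 48 67 68 78 : $-49/8$ 16. 13 15 18 24 26 28 37 38 46 47 56 57 68 78 : $-49/4$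 17. 13 14 18 25 26 28 36 38 47 48 56 57 67 78 : $-49/4$ 18. 12 14 18 23 28 35 37 46 48 56 57 67 68 78 : $-7$ 19. 12 14 18 23 28 36 38 46 47 56 57 58 67 78 : $-7$ 20. 12 15 16 25 27 35 36 38 46 47 48 58 67 78 : $49/8$ 21. 12 14 18 23 28 36 37 46 47 56 57 58 68 78 : $49/8$ 22. 12 13 15 26 27 35 36 45 47 48 58 67 68 78 : $-7$ 23. 12 13 18 24 28 35 38 46 47 57 58 67 68 78 : $7$ 24. 12 13 18 25 26 37 38 45 46 47 56 57 68 78 : $-7$ 25. 12 14 16 23 25 36 37 45 48 57 58 67 68 78 : $77/8$ 26. 13 16 17 24 25 26 35 37 45 48 58 67 68 78 : $-7$ 27. 14 15 17 23 26 28 37 38 46 48 56 57 68 78 : $49/4$ 28. 12 16 18 27 28 34 36 38 46 47 56 57 58 78 : $-147/8$ 29. 12 15 16 27 28 35 36 38 45 46 47 57 68 78 : $-21/8$ 30. 12 14 18 23 27 35 36 45 46 57 58 67 68 78 : $-35/8$ 31. 14 15 16 23 26 28 37 38 46 48 57 58 67 78 : $-49/4$ 32. 12 15 18 23 28 34 37 46 48 56 57 67 68 78 : $105/8$ 33. 12 14 17 23 26 37 38 46 48 56 57 58 68 78 : $-49/8$ 34. 12 16 18 25 27 35 36 37 45 46 48 57 68 78 : $49/16$ 35. 12 13 18 25 27 35 36 46 47 48 56 57 68 78 : $7$ 36. 12 14 18 25 28 34 36 38 47 57 58 67 68 78 : $-7$ 37. 12 16 18 25 27 35 36 37 45 46 48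 58 67 78 : $-77/16$ 38. 12 14 18 23 27 35 38 46 47 57 58 67 68 78 : $77/4$ 39. 12 14 15 23 27 36 38 46 48 57 58 67 68 78 : $35/2$ 40. 12 13 18 25 27 34 36 46 48 57 58 67 68 78 : $-105/8$ 41. 12 15 16 25 27 35 36 38 46 47 48 57 68 78 : $-7$ 42. 12 13 16 25 28 34 37 47 48 57 58 67 68 78 : $-147/16$ 43. 12 13 17 25 26 35 37 45 46 48 58 67 68 78 : $-77/4$ 44. 12 14 17 23 27 35 38 46 48 57 58 67 68 78 : $-49/8$ 45. 12 13 15 26 28 35 37 45 46 47 58 67 68 78 : $-7/4$ 46. 12 14 18 23 26 36 38 47 48 56 57 58 67 78 : $-7$ (Term 1 is the heptagon wheel: vertex 8 is joined to all of $1,\dots,7$, which form the cycle $1\!-\!6\!-\!4\!-\!3\!-\!2\!-\!5\!-\!7\!-\!1$.) Then $\mathrm{d}(\boldsymbol{\gamma}_7)=0$ in the non-oriented graph complex, and $\boldsymbol{\gamma}_7$ is a representative of the heptagon-wheel cohomology class, i.e. of the nontrivial $\mathrm{d}$-cohomology class in the connected graph complex in bi-degree ($8$ vertices, $14$ edges) that contains the heptagon wheel with nonzero coefficient.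
   Context: Non-oriented graph complex. Consider the real vector space spanned by finite non-oriented graphs without multiple edges and without loops (tadpoles), each equipped with a total ordering of its edge set, written as a wedge product $e_1\wedge\cdots\wedge e_m$. Two such graphs that are isomorphic are identified if the isomorphism induces an even permutation of the ordered edges, and are opposite (one equals $-1$ times the other) if it induces an odd permutation. A graph admitting an automorphism inducing an odd permutation of its edges therefore equals minus itself and is zero (a ''zero graph''). Insertion: for graphs $\gamma_1,\gamma_2$, $\gamma_1\circ\gamma_2$ is the sum, over all vertices $v$ of $\gamma_2$ and over all ways of re-attaching each edge formerly incident to $v$ to some vertex of $\gamma_1$, of the graph obtained by replacing $v$ with a copy of $\gamma_1$; the edge ordering of each term is $E(\gamma_1)\wedge E(\gamma_2)$. Extended bilinearly. The bracket is $[\gamma_1,\gamma_2]=\gamma_1\circ\gamma_2-(-1)^{\#E(\gamma_1)\#E(\gamma_2)}\gamma_2\circ\gamma_1$, and the differential is $\mathrm{d}(\gamma)=[\bullet\!-\!\bullet,\gamma]$, where $\bullet\!-\!\bullet$ is the graph with two vertices and one edge; $\mathrm{d}^2=0$. A cocycle is an element of $\ker\mathrm{d}$; cohomology classes are taken modulo $\mathrm{im}\,\mathrm{d}$. The number of vertices and of edges are preserved by insertion in the obvious way, giving a bi-grading ($\#$vertices, $\#$edges). For $\ell\ge1$, the $(2\ell+1)$-wheel is the graph consisting of a cycle on $2\ell+1$ vertices together with an extra (axis) vertex joined to each of them. *)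

(* Defs.v *)
From mathcomp Require Import all_boot all_order all_algebra all_fingroup.
From mathcomp Require Import reals.
Set Implicit Arguments.
Unset Strict Implicit.
Unset Printing Implicit Defensive.
Import GRing.Theory Num.Theory.
(* A graph is (n, E): vertex set {0,...,n-1}, and E the list of its edges,
   in order (the wedge ordering e_1 /\ ... /\ e_m).  Edges are unordered pairs,
   written as pairs of nats (the orientation of a pair is irrelevant). *)
Definition edge := (nat * nat)%type.
Definition graph := (nat * seq edge)%type.

Definition nverts (g : graph) : nat := g.1.
Definition nedges (g : graph) : nat := size g.2.

Definition same_edge (e f : edge) : bool := (e == f) || (e == (f.2, f.1)).
Definition norm_edge (e : edge) : edge := (minn e.1 e.2, maxn e.1 e.2).

Definition simple_graph (g : graph) : bool :=
  all (fun e : edge => [&& e.1 < g.1, e.2 < g.1 & e.1 != e.2]) g.2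
  && uniq (map norm_edge g.2).

Definition adj (g : graph) : rel 'I_(g.1) :=
  fun i j => has (same_edge (val i, val j)) g.2.

Definition connected_graph (g : graph) : Prop :=
  0 < g.1 /\ forall i j : 'I_(g.1), connect (@adj g) i j.

Definition relabv (n : nat) (s : {perm 'I_n}) (k : nat) : nat :=
  match (insub k : option 'I_n) with Some i => val (s i) | None => k end.
Definition relab (n : nat) (s : {perm 'I_n}) (e : edge) : edge :=
  (relabv s e.1, relabv s e.2).

Definition iso_sign (g g' : graph) (b : bool) : Prop :=
  g.1 = g'.1 /\ size g.2 = size g'.2 /\
  exists (s : {perm 'I_(g.1)}) (p : {perm 'I_(size g.2)}),
    (forall i : 'I_(size g.2),
       same_edge (nth (0, 0)%N g'.2 (p i)) (relab s (nth (0, 0)%N g.2 i)))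
    /\ b = odd_perm p.

Definition isomorphic (g g' : graph) : Prop := exists b, iso_sign g g' b.

Section Chains.
Variable R : realType.
Local Open Scope ring_scope.

Definition chain := seq (R * graph).

Definition coef (c : chain) (g : graph) : R :=
  \sum_(p <- c | p.2 == g) p.1.

Definition scalec (a : R) (c : chain) : chain := [seq (a * p.1, p.2) | p <- c].

Definition relvec (r : R * graph * graph * bool) : chain :=
  [:: (r.1.1.1, r.1.1.2); (- (r.1.1.1 * (-1) ^+ r.2), r.1.2)].

Definition valid_rel (r : R * graph * graph * bool) : Prop :=
  simple_graph r.1.1.2 /\ iso_sign r.1.1.2 r.1.2 r.2.

(* c is zero in the graph complex: it lies in the span of the relations
   identifying isomorphic graphs up to the sign of the induced edge
   permutation. *)
Definition gc_zero (c : chain) : Prop :=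
  exists rs : seq (R * graph * graph * bool),
    (forall r, r \in rs -> valid_rel r) /\
    forall g, coef c g = coef (flatten (map relvec rs)) g.

Definition gc_eq (c1 c2 : chain) : Prop := gc_zero (c1 ++ scalec (-1) c2).

Fixpoint assignments (n1 k : nat) : seq (seq nat) :=
  match k with
  | 0 => [:: [::]]
  | k'.+1 => [seq x :: s | x <- iota 0 n1, s <- assignments n1 k']
  end.

Definition incident (v : nat) (e : edge) : bool := (e.1 == v) || (e.2 == v).

(* replace the endpoint v of the edges incident to v by the chosen vertices
   (of the inserted graph); relabel the other vertices by sh *)
Fixpoint reattach (v : nat) (sh : nat -> nat) (E : seq edge) (f : seq nat)
  : seq edge :=
  match E with
  | [::] => [::]
  | e :: E' =>
      if incident v e then
        (if e.1 == v then (head 0%N f, sh e.2) else (sh e.1, head 0%N f))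
          :: reattach v sh E' (behead f)
      else (sh e.1, sh e.2) :: reattach v sh E' f
  end.

(* vertices of g1 become 0..n1-1; vertices u <> v of g2 become n1 + (rank of u) *)
Definition shiftv (n1 v u : nat) : nat := (n1 + (if u < v then u else u.-1))%N.

(* g1 o g2 : sum over vertices v of g2 and reattachments of the edges at v,
   of g2 with v replaced by g1; edge ordering E(g1) /\ E(g2). *)
Definition ins (g1 g2 : graph) : chain :=
  flatten [seq [seq (1, ((g1.1 + g2.1).-1, g1.2 ++ reattach v (shiftv g1.1 v) g2.2 f))
               | f <- assignments g1.1 (count (incident v) g2.2)]
          | v <- iota 0 g2.1].

Definition bracket_g (g1 g2 : graph) : chain :=
  ins g1 g2 ++ scalec (- (-1) ^+ (nedges g1 * nedges g2)) (ins g2 g1).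

Definition bracket (c1 c2 : chain) : chain :=
  flatten [seq scalec (p.1 * q.1) (bracket_g p.2 q.2) | p <- c1, q <- c2].

Definition edge_graph : graph := (2%N, [:: (0, 1)%N]).

Definition d (c : chain) : chain := bracket [:: (1, edge_graph)] c.

(* edges written as in the paper: the two-digit number ij is the edge {i,j}
   on vertices 1..8, which we relabel to 0..7 *)
Definition edge_of (k : nat) : edge := ((k %/ 10).-1, (k %% 10).-1)%N.
Definition gr8 (l : seq nat) : graph := (8%N, map edge_of l).
Definition q (a : int) (b : nat) : R := a%:~R / b%:R.

Definition heptagon_wheel : graph :=
  gr8 [:: 16; 17; 18; 23; 25; 28; 34; 38; 46; 48; 57; 58; 68; 78]%N.

Definition gamma7 : chain := [::
 (q 1 1, heptagon_wheel);
 (q (-21) 8, gr8 [:: 12; 14; 18; 23; 27; 35; 37; 46; 48; 57; 58; 67; 68; 78]%N);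
 (q (-77) 4, gr8 [:: 13; 14; 18; 23; 25; 28; 37; 46; 48; 56; 57; 67; 68; 78]%N);
 (q (-35) 8, gr8 [:: 12; 13; 15; 24; 27; 35; 36; 46; 48; 57; 58; 67; 68; 78]%N);
 (q 49 8, gr8 [:: 12; 13; 18; 24; 26; 37; 38; 46; 47; 56; 57; 58; 68; 78]%N);
 (q 77 8, gr8 [:: 14; 17; 18; 23; 25; 26; 35; 37; 46; 48; 56; 58; 67; 78]%N);
 (q (-105) 8, gr8 [:: 12; 13; 18; 26; 27; 35; 38; 45; 46; 47; 56; 57; 68; 78]%N);
 (q 7 8, gr8 [:: 12; 14; 18; 23; 27; 36; 38; 46; 48; 56; 57; 58; 67; 78]%N);
 (q 35 8, gr8 [:: 12; 14; 15; 23; 27; 35; 36; 46; 48; 57; 58; 67; 68; 78]%N);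
 (q (-49) 8, gr8 [:: 12; 13; 14; 27; 28; 36; 38; 46; 47; 56; 57; 58; 68; 78]%N);
 (q 35 4, gr8 [:: 12; 13; 18; 25; 27; 34; 36; 47; 48; 56; 58; 67; 68; 78]%N);
 (q (-119) 16, gr8 [:: 12; 13; 14; 25; 26; 36; 38; 45; 47; 57; 58; 67; 68; 78]%N);
 (q 49 8, gr8 [:: 12; 13; 15; 24; 28; 36; 38; 47; 48; 56; 57; 67; 68; 78]%N);
 (q 77 4, gr8 [:: 12; 13; 14; 23; 28; 37; 46; 48; 56; 57; 58; 67; 68; 78]%N);
 (q (-49) 8, gr8 [:: 12; 15; 17; 25; 26; 35; 36; 38; 45; 47; 48; 67; 68; 78]%N);
 (q (-49) 4, gr8 [:: 13; 15; 18; 24; 26; 28; 37; 38; 46; 47; 56; 57; 68; 78]%N);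
 (q (-49) 4, gr8 [:: 13; 14; 18; 25; 26; 28; 36; 38; 47; 48; 56; 57; 67; 78]%N);
 (q (-7) 1, gr8 [:: 12; 14; 18; 23; 28; 35; 37; 46; 48; 56; 57; 67; 68; 78]%N);
 (q (-7) 1, gr8 [:: 12; 14; 18; 23; 28; 36; 38; 46; 47; 56; 57; 58; 67; 78]%N);
 (q 49 8, gr8 [:: 12; 15; 16; 25; 27; 35; 36; 38; 46; 47; 48; 58; 67; 78]%N);
 (q 49 8, gr8 [:: 12; 14; 18; 23; 28; 36; 37; 46; 47; 56; 57; 58; 68; 78]%N);
 (q (-7) 1, gr8 [:: 12; 13; 15; 26; 27; 35; 36; 45; 47; 48; 58; 67; 68; 78]%N);
 (q 7 1, gr8 [:: 12; 13; 18; 24; 28; 35; 38; 46; 47; 57; 58; 67; 68; 78]%N);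
 (q (-7) 1, gr8 [:: 12; 13; 18; 25; 26; 37; 38; 45; 46; 47; 56; 57; 68; 78]%N);
 (q 77 8, gr8 [:: 12; 14; 16; 23; 25; 36; 37; 45; 48; 57; 58; 67; 68; 78]%N);
 (q (-7) 1, gr8 [:: 13; 16; 17; 24; 25; 26; 35; 37; 45; 48; 58; 67; 68; 78]%N);
 (q 49 4, gr8 [:: 14; 15; 17; 23; 26; 28; 37; 38; 46; 48; 56; 57; 68; 78]%N);
 (q (-147) 8, gr8 [:: 12; 16; 18; 27; 28; 34; 36; 38; 46; 47; 56; 57; 58; 78]%N);
 (q (-21) 8, gr8 [:: 12; 15; 16; 27; 28; 35; 36; 38; 45; 46; 47; 57; 68; 78]%N);
 (q (-35) 8, gr8 [:: 12; 14; 18; 23; 27; 35; 36; 45; 46; 57; 58; 67; 68; 78]%N);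
 (q (-49) 4, gr8 [:: 14; 15; 16; 23; 26; 28; 37; 38; 46; 48; 57; 58; 67; 78]%N);
 (q 105 8, gr8 [:: 12; 15; 18; 23; 28; 34; 37; 46; 48; 56; 57; 67; 68; 78]%N);
 (q (-49) 8, gr8 [:: 12; 14; 17; 23; 26; 37; 38; 46; 48; 56; 57; 58; 68; 78]%N);
 (q 49 16, gr8 [:: 12; 16; 18; 25; 27; 35; 36; 37; 45; 46; 48; 57; 68; 78]%N);
 (q 7 1, gr8 [:: 12; 13; 18; 25; 27; 35; 36; 46; 47; 48; 56; 57; 68; 78]%N);
 (q (-7) 1, gr8 [:: 12; 14; 18; 25; 28; 34; 36; 38; 47; 57; 58; 67; 68; 78]%N);
 (q (-77) 16, gr8 [:: 12; 16; 18; 25; 27; 35; 36; 37; 45; 46; 48; 58; 67; 78]%N);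
 (q 77 4, gr8 [:: 12; 14; 18; 23; 27; 35; 38; 46; 47; 57; 58; 67; 68; 78]%N);
 (q 35 2, gr8 [:: 12; 14; 15; 23; 27; 36; 38; 46; 48; 57; 58; 67; 68; 78]%N);
 (q (-105) 8, gr8 [:: 12; 13; 18; 25; 27; 34; 36; 46; 48; 57; 58; 67; 68; 78]%N);
 (q (-7) 1, gr8 [:: 12; 15; 16; 25; 27; 35; 36; 38; 46; 47; 48; 57; 68; 78]%N);
 (q (-147) 16, gr8 [:: 12; 13; 16; 25; 28; 34; 37; 47; 48; 57; 58; 67; 68; 78]%N);
 (q (-77) 4, gr8 [:: 12; 13; 17; 25; 26; 35; 37; 45; 46; 48; 58; 67; 68; 78]%N);
 (q (-49) 8, gr8 [:: 12; 14; 17; 23; 27; 35; 38; 46; 48; 57; 58; 67; 68; 78]%N);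
 (q (-7) 4, gr8 [:: 12; 13; 15; 26; 28; 35; 37; 45; 46; 47; 58; 67; 68; 78]%N);
 (q (-7) 1, gr8 [:: 12; 14; 18; 23; 26; 36; 38; 47; 48; 56; 57; 58; 67; 78]%N)
].

End Chains.

(* Main.v *)
(* Every edge of the wheel lies in a triangle.  In the differential of a simple
   graph each term has an edge that does not: a pendant edge, or the edge created
   by splitting a vertex, whose ends have no common neighbour.  As all
   automorphisms of the heptagon wheel are even (a dihedral symmetry permutes the
   spokes and the opposite rim edges in the same way), the signed coefficient of
   the wheel is a well-defined functional on the complex; it vanishes on
   coboundaries and equals 1 on gamma_7.

   That gamma_7 is a cocycle is a finite computation: each of the 5528 terms of
   the differential is brought to a canonical form by an explicit relabeling, and
   each canonical graph then has total coefficient 0 or an odd automorphism. *)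
Require Import Defs.
From mathcomp Require Import all_boot all_order all_algebra all_fingroup.
From mathcomp Require Import boolp reals zify ring lra.
Set Implicit Arguments.
Unset Strict Implicit.
Unset Printing Implicit Defensive.
Import GRing.Theory Num.Theory.

(** * Signed isomorphisms *)

(** With a free [m] tied to both sizes by equations, [p] and its inverse have the same type,
    whichever list comes first. *)
Definition resort (T : eqType) (x0 : T) (l l' : seq T) (b : bool) : Prop :=
  exists m (p : 'S_m), [/\ size l = m, size l' = m,
    forall i : 'I_m, nth x0 l' (p i) = nth x0 l i & b = odd_perm p].

Section Resort.
Variables (T : eqType) (x0 : T).
Implicit Types l : seq T.

Lemma resort_refl l : resort x0 l l false.
Proof.
by exists (size l), 1%g; split=> // [i|]; rewrite ?perm1 ?odd_perm1.
Qed.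

Lemma resort_sym l l' b : resort x0 l l' b -> resort x0 l' l b.
Proof.
move=> [m [p [sl sl' Hp ->]]]; exists m, p^-1%g; split=> // [i|].
  by rewrite -{2}(permKV p i) Hp.
by rewrite odd_permV.
Qed.

Lemma resort_trans l1 l2 l3 b c :
  resort x0 l1 l2 b -> resort x0 l2 l3 c -> resort x0 l1 l3 (b (+) c).
Proof.
move=> [m [p [s1 s2 Hp ->]]] [m' [r [s2']]].
have em : m = m' by rewrite -s2' s2.
case: m' / em r s2' => r _ s3 Hr ->; exists m, (p * r)%g; split=> // [i|].
  by rewrite permM Hr Hp.
by rewrite odd_permM.
Qed.

Lemma resort_perm_eq l l' b : resort x0 l l' b -> perm_eq l l'.
Proof.
move=> [m [p [sl sl' Hp _]]]; apply/seq.permP => a.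
rewrite -!sum1_count !(big_nth x0) !big_mkord sl sl'.
apply/esym; rewrite (reindex_inj (@perm_inj _ p)) /=.
by apply: eq_bigl => i; rewrite Hp.
Qed.

(** One resorting followed by the inverse of the other fixes every entry of [l]; as the entries are
    distinct it is the identity, which is even. *)
Lemma resort_uniq l l' b c :
  uniq l -> resort x0 l l' b -> resort x0 l l' c -> b = c.
Proof.
move=> Ul H1 /resort_sym H2.
have [m [p [sl _ Hp]]] := resort_trans H1 H2.
suff -> : p = 1%g by rewrite odd_perm1; case: b c {H1 H2} => [] [].
apply/permP => i; apply/val_inj/eqP; rewrite perm1 /=.
by rewrite -(nth_uniq x0 _ _ Ul) ?sl // Hp.
Qed.

Lemma resort_cons x l l1 l2 b : resort x0 l (l1 ++ l2) b ->
  resort x0 (x :: l) (l1 ++ x :: l2) (odd (size l1) (+) b).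
Proof.
move=> [m [p [sl sl' Hp ->]]].
have lt1 : size l1 < m.+1 by rewrite -sl' size_cat ltnS leq_addr.
pose j : 'I_m.+1 := Ordinal lt1.
(* This sends position 0 to [size l1] and follows [p] on the rest; the parity changes by that of
   [j]. *)
exists m.+1, (lift_perm ord0 j p); split.
- by rewrite /= sl.
- by rewrite size_cat /= addnS -size_cat sl'.
- move=> i; case: (unliftP ord0 i) => [k|] ->; last first.
    by rewrite lift_perm_id /= nth_cat ltnn subnn.
  rewrite lift_perm_lift /= -Hp !nth_cat /bump /=.
  case: (leqP (size l1) (p k)) => h.
    by rewrite add1n ltnNge (leqW h) /= subSn //= ltnNge h.
  by rewrite add0n h.
- by rewrite odd_lift_perm /=.
Qed.

Lemma resort_map (U : eqType) (y0 : U) (f : T -> U) l l' b :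
  resort x0 l l' b -> resort y0 (map f l) (map f l') b.
Proof.
move=> [m [p [sl sl' Hp ->]]]; exists m, p; split; rewrite ?size_map // => i.
by rewrite !(nth_map x0) ?sl ?sl' // Hp.
Qed.

End Resort.

Lemma norm_edgeP (e f : edge) : reflect (norm_edge e = norm_edge f) (same_edge e f).
Proof.
case: e f => [a b] [c d]; rewrite /same_edge /norm_edge /= -!pair_eqE /pair_eq /=.
apply: (iffP idP).
  by case/orP=> /andP[/eqP-> /eqP->] //; rewrite minnC maxnC.
move=> [].
case: (leqP a b) => h1; case: (leqP c d) => h2 -> ->; rewrite ?eqxx ?orbT //.
Qed.

Lemma norm_edge_id e : norm_edge (norm_edge e) = norm_edge e.
Proof.
case: e => a b; rewrite /norm_edge /=; case: (leqP a b) => h.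
  by rewrite (minn_idPl h) (maxn_idPr h).
by rewrite (minn_idPl (ltnW h)) (maxn_idPr (ltnW h)).
Qed.

Lemma norm_edgeC a b : norm_edge (a, b) = norm_edge (b, a).
Proof. by rewrite /norm_edge /= minnC maxnC. Qed.

Lemma norm_edgeE e : norm_edge e = e \/ norm_edge e = (e.2, e.1).
Proof. by case: e => a b; rewrite /norm_edge /=; case: leqP; [left|right]. Qed.

Lemma norm_edge_map (h : nat -> nat) (e : edge) :
  norm_edge (h (norm_edge e).1, h (norm_edge e).2) = norm_edge (h e.1, h e.2).
Proof. by case: (norm_edgeE e) => -> //=; rewrite norm_edgeC. Qed.

Lemma norm_relab n (s : {perm 'I_n}) e :
  norm_edge (relab s (norm_edge e)) = norm_edge (relab s e).
Proof. exact: norm_edge_map. Qed.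

Lemma relabv_ord n (s : {perm 'I_n}) (i : 'I_n) : relabv s i = s i.
Proof. by rewrite /relabv insubT //= => h; congr (val (s _)); apply: val_inj. Qed.

Lemma relabv_out n (s : {perm 'I_n}) k : n <= k -> relabv s k = k.
Proof. by move=> h; rewrite /relabv insubF // ltnNge h. Qed.

Lemma relabvM n (s r : {perm 'I_n}) k : relabv r (relabv s k) = relabv (s * r)%g k.
Proof.
case: (ltnP k n) => h; last by rewrite !(relabv_out _ h).
by rewrite -[k]/(val (Ordinal h)) !relabv_ord permM.
Qed.

Lemma relabv1 n k : relabv (1%g : {perm 'I_n}) k = k.
Proof.
case: (ltnP k n) => h; last by rewrite relabv_out.
by rewrite -[k in LHS]/(val (Ordinal h)) relabv_ord perm1.
Qed.

Lemma relabvK n (s : {perm 'I_n}) : cancel (relabv s) (relabv s^-1%g).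
Proof. by move=> k; rewrite relabvM mulgV relabv1. Qed.

Lemma relabM n (s r : {perm 'I_n}) e : relab r (relab s e) = relab (s * r)%g e.
Proof. by rewrite /relab /= !relabvM. Qed.

Lemma relab1 n e : relab (1%g : {perm 'I_n}) e = e.
Proof. by case: e => a b; rewrite /relab /= !relabv1. Qed.

Notation eresort := (resort ((0, 0)%N : edge)).

(** Passing to [norm_edge] turns agreement up to orientation into equality, so that the results on
    [resort] apply to edge lists. *)
Lemma iso_signP n n' (E E' : seq edge) b :
  iso_sign (n, E) (n', E') b <->
  n = n' /\ exists s : {perm 'I_n},
    eresort (map (fun e => norm_edge (relab s e)) E) (map norm_edge E') b.
Proof.
split.
  move=> [/= -> [sE [s [p [Hp ->]]]]]; split=> //; exists s.
  exists (size E), p; split; rewrite ?size_map // => i.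
  rewrite !(nth_map (0, 0)%N) -?sE //.
  exact/norm_edgeP/Hp.
move=> [-> [s [m [p []]]]]; rewrite !size_map => sE sE' Hp ->.
subst m; split=> //; split=> //; exists s, p; split=> // i.
apply/norm_edgeP; move: (Hp i); rewrite !(nth_map (0, 0)%N) //.
by rewrite sE'.
Qed.

Lemma iso_sign_sym g g' b : iso_sign g g' b -> iso_sign g' g b.
Proof.
case: g g' => n E [n' E'] /iso_signP [en [s Hs]]; subst n'.
apply/iso_signP; split=> //; exists s^-1%g; apply: resort_sym.
move/(resort_map (0, 0)%N (fun e => norm_edge (relab s^-1%g e))): Hs.
rewrite -!map_comp; congr (eresort _ _ _); apply: eq_map => e /=.
  by rewrite norm_relab relabM mulgV relab1.
by rewrite norm_relab.
Qed.

Lemma iso_sign_trans g1 g2 g3 b c :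
  iso_sign g1 g2 b -> iso_sign g2 g3 c -> iso_sign g1 g3 (b (+) c).
Proof.
case: g1 g2 g3 => n E1 [n2 E2] [n3 E3] /iso_signP [en [s Hs]]; subst n2.
move=> /iso_signP [en [r Hr]]; subst n3.
apply/iso_signP; split=> //; exists (s * r)%g.
apply: resort_trans Hr.
move/(resort_map (0, 0)%N (fun e => norm_edge (relab r e))): Hs.
rewrite -!map_comp; congr (eresort _ _ _); apply: eq_map => e /=.
  by rewrite norm_relab relabM.
by rewrite norm_relab.
Qed.

Lemma iso_sign_edges n n' E E' b : iso_sign (n, E) (n', E') b ->
  exists s : {perm 'I_n},
    perm_eq (map (fun e => norm_edge (relab s e)) E) (map norm_edge E').
Proof.
by move=> /iso_signP [_ [s /resort_perm_eq Hs]]; exists s.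
Qed.

(** * Sorting edges with signs *)

(* The default value [k] fixes the vertices beyond the list, as [relabv] does. *)
Definition relabl (t : seq nat) (k : nat) : nat := nth k t k.

Lemma relabl_map_iota n (s : {perm 'I_n}) :
  relabl (map (relabv s) (iota 0 n)) =1 relabv s.
Proof.
move=> k; rewrite /relabl; case: (ltnP k n) => h; last first.
  by rewrite nth_default ?size_map ?size_iota // relabv_out.
by rewrite (nth_map 0) ?size_iota // nth_iota.
Qed.

Lemma relabv_lt n (s : {perm 'I_n}) k : (relabv s k < n) = (k < n).
Proof.
case: (ltnP k n) => h; last by rewrite relabv_out // ltnNge h.
by rewrite -[k]/(val (Ordinal h)) relabv_ord ltn_ord.
Qed.

Lemma perm_eq_relabv_iota n (s : {perm 'I_n}) :
  perm_eq (map (relabv s) (iota 0 n)) (iota 0 n).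
Proof.
have Us : uniq (map (relabv s) (iota 0 n)).
  by rewrite (map_inj_uniq (can_inj (relabvK s))) iota_uniq.
apply: uniq_perm => //; first exact: iota_uniq.
apply: (uniq_min_size Us _ _).2; last by rewrite size_map.
by move=> k /mapP [j]; rewrite !mem_iota /= => h ->; rewrite relabv_lt.
Qed.

Lemma perm_of_labels n t : perm_eq t (iota 0 n) ->
  exists s : {perm 'I_n}, relabv s =1 relabl t.
Proof.
move=> Ht; have st : size t = n by rewrite (perm_size Ht) size_iota.
have lt i : i < n -> nth 0 t i < n.
  by rewrite -{1}st => /(mem_nth 0); rewrite (perm_mem Ht) mem_iota.
pose f (i : 'I_n) := Ordinal (lt i (ltn_ord i)).
have f_inj : injective f.
  move=> i j /(congr1 val) /= /eqP; rewrite nth_uniq ?st //.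
    by move/eqP/val_inj.
  by rewrite (perm_uniq Ht) iota_uniq.
exists (perm f_inj) => k; rewrite /relabl.
case: (ltnP k n) => h; last by rewrite relabv_out // nth_default // st.
rewrite -[k in relabv _ k]/(val (Ordinal h)) relabv_ord permE /=.
by apply: set_nth_default; rewrite st.
Qed.

Definition lt_edge (e f : edge) : bool :=
  (e.1 < f.1) || ((e.1 == f.1) && (e.2 < f.2)).

(** One step of an insertion sort that records its sign: the Boolean is the parity of the number of
    entries passed. *)
Fixpoint place (e : edge) (l : seq edge) : bool * seq edge :=
  if l is f :: l' then
    if lt_edge f e then let (b, r) := place e l' in (~~ b, f :: r)
    else (false, e :: l)
  else (false, [:: e]).

Fixpoint esort (l : seq edge) : bool * seq edge :=
  if l is e :: l' then
    let (b, r) := esort l' in let (c, r') := place e r in (c (+) b, r')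
  else (false, [::]).

Lemma placeE e l : exists l1 l2,
  l = l1 ++ l2 /\ place e l = (odd (size l1), l1 ++ e :: l2).
Proof.
elim: l => [|f l [l1 [l2 [-> IH]]]] /=; first by exists [::], [::].
case: lt_edge; last by exists [::], (f :: l1 ++ l2).
by exists (f :: l1), l2; rewrite IH.
Qed.

Lemma esort_resort l : eresort l (esort l).2 (esort l).1.
Proof.
elim: l => [|e l] /=; first exact: resort_refl.
case: (esort l) => b r /=; have [l1 [l2 [-> ->]]] := placeE e r.
exact: resort_cons.
Qed.

Definition nform (t : seq nat) (E : seq edge) : bool * seq edge :=
  esort [seq norm_edge (relabl t e.1, relabl t e.2) | e <- E].

Lemma nform_iso n t E : perm_eq t (iota 0 n) ->
  iso_sign (n, E) (n, (nform t E).2) (nform t E).1.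
Proof.
move=> /perm_of_labels [s Hs]; apply/iso_signP; split=> //; exists s.
have := esort_resort [seq norm_edge (relabl t e.1, relabl t e.2) | e <- E].
move/(resort_map (0, 0)%N norm_edge); rewrite -map_comp.
congr (eresort _ _ _); apply: eq_map => e /=.
by rewrite norm_edge_id /relab !Hs.
Qed.

Lemma incident_norm v e : incident v (norm_edge e) = incident v e.
Proof. by case: (norm_edgeE e) => -> //; rewrite /incident orbC. Qed.

Lemma count_incident_relab n (s : {perm 'I_n}) E E' (v : nat) :
  perm_eq (map (fun e => norm_edge (relab s e)) E) (map norm_edge E') ->
  count (incident (relabv s v)) E' = count (incident v) E.
Proof.
move/seq.permP/(_ (incident (relabv s v))); rewrite !count_map.
have -> : count (preim norm_edge (incident (relabv s v))) E' =
          count (incident (relabv s v)) E'.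
  by apply: eq_count => e /=; rewrite incident_norm.
move <-; apply: eq_count => e /=; rewrite incident_norm /incident /=.
by rewrite !(inj_eq (can_inj (relabvK s))).
Qed.

(** * The heptagon wheel *)

(** Vertices count from 0, so the hub is 7. *)
Definition wheel_edges : seq edge := Eval vm_compute in heptagon_wheel.2.

Lemma heptagon_wheelE : heptagon_wheel = (8, wheel_edges).
Proof. by []. Qed.

Lemma norm_wheel_edges : map norm_edge wheel_edges = wheel_edges.
Proof. by []. Qed.

(** The hub is the only vertex of degree 7, hence fixed; what remains is a check over the 5040
    permutations of the rim. *)
Lemma wheel_automorphisms_even b :
  iso_sign heptagon_wheel heptagon_wheel b -> b = false.
Proof.
rewrite heptagon_wheelE => /iso_signP [_ [s]].
rewrite norm_wheel_edges => Hs.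
have Ps := resort_perm_eq Hs.
have s7 : relabv s 7 = 7.
  have lt7 : relabv s 7 < 8 by rewrite relabv_lt.
  have := @count_incident_relab _ s wheel_edges wheel_edges 7.
  rewrite norm_wheel_edges => /(_ Ps).
  by move: (relabv s 7) lt7; do 8?[case=> //].
set t := map (relabv s) (iota 0 7).
have tE : map (relabv s) (iota 0 8) = rcons t 7 by rewrite /= s7.
have Pt8 : perm_eq (rcons t 7) (iota 0 8).
  by rewrite -tE perm_eq_relabv_iota.
have Pt : t \in permutations (iota 0 7).
  move: Pt8; rewrite mem_permutations -cats1 -[iota 0 8]/(iota 0 7 ++ [:: 7]).
  by rewrite perm_cat2r.
have relE e : norm_edge (relab s e) =
    norm_edge (relabl (rcons t 7) e.1, relabl (rcons t 7) e.2).
  by rewrite -tE !relabl_map_iota.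
have check : all (fun t => let t' := rcons t 7 in
    all (fun e => norm_edge (relabl t' e.1, relabl t' e.2) \in wheel_edges)
      wheel_edges ==> (nform t' wheel_edges == (false, wheel_edges)))
    (permutations (iota 0 7)) by vm_compute.
have /implyP ok := allP check _ Pt.
have /eqP nE : nform (rcons t 7) wheel_edges == (false, wheel_edges).
  apply: ok; apply/allP => e He; rewrite -relE -(perm_mem Ps).
  by apply/mapP; exists e.
have := esort_resort
  [seq norm_edge (relabl (rcons t 7) e.1, relabl (rcons t 7) e.2)
     | e <- wheel_edges].
rewrite -/(nform _ _) nE => Hs'.
(* The image edges are distinct, so [b] must be the computed sign. *)
apply: resort_uniq Hs _; last first.
  by move: Hs'; congr (eresort _ _ _); apply: eq_map => e; rewrite relE.
by rewrite (perm_uniq Ps).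
Qed.

Definition in_triangle (E : seq edge) (e : edge) : Prop :=
  exists2 w, norm_edge (e.1, w) \in map norm_edge E
           & norm_edge (e.2, w) \in map norm_edge E.

(** A rim edge forms a triangle with the hub, a spoke with a neighbour on the rim; this is computed
    on the wheel and carried back along the isomorphism. *)
Lemma wheel_edge_in_triangle g b e :
  iso_sign g heptagon_wheel b -> e \in g.2 -> in_triangle g.2 e.
Proof.
case: g => n E; rewrite heptagon_wheelE => /iso_sign_edges [s Ps] /= He.
have fin f : f \in wheel_edges -> exists w,
    (norm_edge (f.1, w) \in wheel_edges) && (norm_edge (f.2, w) \in wheel_edges).
  move=> Hf; have : all (fun f => has (fun w =>
      (norm_edge (f.1, w) \in wheel_edges) && (norm_edge (f.2, w) \in wheel_edges))
      (iota 0 8)) wheel_edges by [].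
  by move/allP/(_ f Hf)/hasP => [w _ Hw]; exists w.
rewrite norm_wheel_edges in Ps.
have back a w : norm_edge (relabv s a, w) \in wheel_edges ->
    norm_edge (a, relabv s^-1%g w) \in map norm_edge E.
  rewrite -(perm_mem Ps) => /mapP [f Hf].
  move/(congr1 (fun e => norm_edge (relab s^-1%g e))).
  rewrite !norm_relab relabM mulgV relab1 {1}/relab /= relabvK => ->.
  exact: map_f.
have : norm_edge (relab s e) \in wheel_edges.
  by rewrite -(perm_mem Ps); apply/mapP; exists e.
move/fin => [w /andP [h1 h2]]; exists (relabv s^-1%g w); apply: back.
  by case: (norm_edgeE (relab s e)) h1 h2 => ->.
by case: (norm_edgeE (relab s e)) h1 h2 => ->.
Qed.

(** A vertex of degree 7 tells the wheel from the other graphs of [gamma7], none of which has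
    one. *)
Lemma wheel_hub g b : iso_sign g heptagon_wheel b ->
  has (fun v => count (incident v) g.2 == 7) (iota 0 g.1).
Proof.
case: g => n E /iso_sign_sym; rewrite heptagon_wheelE => H.
have [s Ps] := iso_sign_edges H; have c7 := count_incident_relab 7 Ps.
have /iso_signP [n8 _] := H.
apply/hasP; exists (relabv s 7); last by rewrite /= c7.
by rewrite mem_iota -n8 /= relabv_lt.
Qed.

(** * Terms of the differential *)

(** All coefficients in [ins] are 1; the bare list of graphs involves no real numbers and can be
    computed. *)
Definition ins_terms (g1 g2 : graph) : seq graph :=
  flatten [seq [seq ((g1.1 + g2.1).-1,
                     g1.2 ++ reattach v (shiftv g1.1 v) g2.2 f)
               | f <- assignments g1.1 (count (incident v) g2.2)]
          | v <- iota 0 g2.1].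

Lemma simple_lt n E e : simple_graph (n, E) -> e \in E ->
  [/\ e.1 < n, e.2 < n & e.1 != e.2].
Proof. by move=> /andP [/allP H _] /H /and3P. Qed.

Lemma norm_edge_eqP (a b c d : nat) : norm_edge (a, b) = norm_edge (c, d) ->
  (a = c /\ b = d) \/ (a = d /\ b = c).
Proof.
move/norm_edgeP; rewrite /same_edge /= -!pair_eqE /pair_eq /=.
by case/orP => /andP [/eqP-> /eqP->]; [left|right].
Qed.

Lemma assignments_lt n k f : f \in assignments n k -> all (fun x => x < n) f.
Proof.
elim: k f => [|k IH] f; first by rewrite inE => /eqP ->.
move=> /allpairsP [[x s] /= [Hx Hs ->]] /=; rewrite IH // andbT.
by move: Hx; rewrite mem_iota.
Qed.

Lemma shiftv_inj n v u u' : u != v -> u' != v -> shiftv n v u = shiftv n v u' -> u = u'.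
Proof.
rewrite /shiftv; move=> /eqP h /eqP h' /addnI.
case: (ltnP u v) => hu; case: (ltnP u' v) => hu'; lia.
Qed.

(** Labels from [shiftv] are at least [n], so an edge at [k < n] can only come from an edge at [v],
    whose other end is [u]. *)
Lemma norm_edge_reattach n v w k E f :
  (forall e, e \in E -> e.1 != e.2) -> all (fun x => x < n) f ->
  0 < n -> k < n ->
  norm_edge (k, w) \in map norm_edge (reattach v (shiftv n v) E f) ->
  exists u, [/\ w = shiftv n v u, u != v & norm_edge (v, u) \in map norm_edge E].
Proof.
move=> + + n_gt0 kn; elim: E f => [|e E IH] f //= loopless fn.
have ge_n u : n <= shiftv n v u by exact: leq_addr.
have IHE f' : all (fun x => x < n) f' ->
    norm_edge (k, w) \in map norm_edge (reattach v (shiftv n v) E f') ->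
    exists u, [/\ w = shiftv n v u, u != v
      & norm_edge (v, u) \in norm_edge e :: map norm_edge E].
  move=> fn' Hk.
  have [e' He'|u [-> uv Hu]] := IH f' _ fn' Hk.
    by apply: loopless; rewrite inE He' orbT.
  by exists u; rewrite inE Hu orbT.
have loope : e.1 != e.2 by apply: loopless; rewrite inE eqxx.
have fn' : all (fun x => x < n) (behead f) by case: f fn => //= ? ? /andP [].
(* If [f] runs out, the default 0 is still a label below [n]. *)
have hfn : head 0 f < n by case: f fn {fn'} => //= ? ? /andP [].
have keep a b : norm_edge (k, w) = norm_edge (a, shiftv n v b) -> a < n ->
    w = shiftv n v b.
  case/norm_edge_eqP => [[_ //]|[kE _]].
  by move: kn; rewrite kE ltnNge ge_n.
case: ifP => [inc|inc]; last first.
  rewrite inE => /orP [/eqP/norm_edge_eqP|]; last exact: IHE.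
  by case=> [] [kE _]; move: kn; rewrite kE ltnNge ge_n.
case: eqP => [e1v|/eqP e1v] /=; rewrite inE => /orP [/eqP|]; try exact: IHE.
  move/keep => ->//; exists e.2; split=> //; first by rewrite -e1v eq_sym.
  by rewrite -e1v inE -surjective_pairing eqxx.
rewrite [norm_edge (_, head 0 f)]norm_edgeC => /keep -> //.
move: inc; rewrite /incident (negbTE e1v) /= => /eqP e2v.
exists e.1; split=> //.
by rewrite -e2v norm_edgeC inE -surjective_pairing eqxx.
Qed.

(** The label [w] determines a neighbour [u] of [v]; a single edge joins [v] to [u], and it is
    reattached at a single vertex. *)
Lemma reattach_inj n v w k k' E f :
  (forall e, e \in E -> e.1 != e.2) -> uniq (map norm_edge E) ->
  all (fun x => x < n) f -> k < n -> k' < n ->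
  norm_edge (k, w) \in map norm_edge (reattach v (shiftv n v) E f) ->
  norm_edge (k', w) \in map norm_edge (reattach v (shiftv n v) E f) ->
  k = k'.
Proof.
move=> + + + kn kn'; have n_gt0 : 0 < n by apply: leq_ltn_trans kn.
elim: E f => [|e E IH] f // loopless Un fn Hk Hk'.
have [u [wu uv Hu]] := norm_edge_reattach loopless fn n_gt0 kn Hk.
have ge_n x : n <= shiftv n v x by exact: leq_addr.
have loopE : forall e', e' \in E -> e'.1 != e'.2.
  by move=> e' He'; apply: loopless; rewrite inE He' orbT.
have [/= NeE UE] := andP Un.
have fn' : all (fun x => x < n) (behead f) by case: f fn {Hk Hk'} => //= ? ? /andP [].
have hfn : head 0 f < n by case: f fn {fn' Hk Hk'} => //= ? ? /andP [].
have loope : e.1 != e.2 by apply: loopless; rewrite inE eqxx.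
have keep j a b : j < n -> norm_edge (j, w) = norm_edge (a, shiftv n v b) -> a < n ->
    w = shiftv n v b /\ j = a.
  move=> jn /norm_edge_eqP [[-> -> //]|[kE _]].
  by move: jn; rewrite kE ltnNge ge_n.
move: Hk Hk' => /=.
case: ifP => [inc|inc]; last first.
  have drop j : j < n -> norm_edge (j, w) != norm_edge (shiftv n v e.1, shiftv n v e.2).
    move=> jn; apply/eqP => /norm_edge_eqP.
    by case=> [] [kE _]; move: jn; rewrite kE ltnNge ge_n.
  by rewrite !inE !(negbTE (drop _ _)) //=; apply: IH.
have [a [av eE edgeE]] : exists a, [/\ a != v, norm_edge e = norm_edge (v, a) &
   norm_edge (if e.1 == v then (head 0 f, shiftv n v e.2) else (shiftv n v e.1, head 0 f))
    = norm_edge (head 0 f, shiftv n v a)].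
  case: eqP => [e1v|/eqP e1v].
    by exists e.2; rewrite -e1v eq_sym loope -surjective_pairing.
  move: inc; rewrite /incident (negbTE e1v) /= => /eqP e2v.
  exists e.1; rewrite -e2v [norm_edge (e.2, _)]norm_edgeC -surjective_pairing.
  by rewrite norm_edgeC.
(* A later edge at [v] with the same far end would repeat [e], against [uniq]. *)
have clash j : j < n ->
    norm_edge (j, w) \in map norm_edge (reattach v (shiftv n v) E (behead f)) ->
    w = shiftv n v a -> False.
  move=> jn Hj wa.
  have [b [wb bv Hb]] := norm_edge_reattach loopE fn' n_gt0 jn Hj.
  have ab : a = b by apply: (shiftv_inj (n := n) av bv); rewrite -wa.
  by move: NeE; rewrite eE ab Hb.
rewrite !inE edgeE.
case/orP => [/eqP h|Hk]; case/orP => [/eqP h'|Hk'].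
- by have [_ ->] := keep _ _ _ kn h hfn; have [_ ->] := keep _ _ _ kn' h' hfn.
- by have [wa _] := keep _ _ _ kn h hfn; case: (clash k').
- by have [wa _] := keep _ _ _ kn' h' hfn; case: (clash k).
- exact: (IH (behead f)).
Qed.

(* Each neighbour of the split vertex is reattached to only one of the two ends
   of the new edge, as the graph is simple. *)
Lemma split_not_in_triangle g x : simple_graph g -> x \in ins_terms edge_graph g ->
  exists2 e, e \in x.2 & ~ in_triangle x.2 e.
Proof.
case: g => n E simE /flatten_mapP [v _ /mapP [f /assignments_lt fn -> /=]].
exists (0, 1); first by rewrite inE eqxx.
have loopless e : e \in E -> e.1 != e.2 by case/(simple_lt simE).
have UE : uniq (map norm_edge E) by case/andP: simE.
move=> [w /=]; rewrite !inE.
have loop k : k < 2 -> norm_edge (k, k) \in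
    map norm_edge (reattach v (shiftv 2 v) E f) -> False.
  move=> k2 /(norm_edge_reattach loopless fn) [] // u [ku _ _].
  by move: k2; rewrite ku ltnNge leq_addr.
move=> /orP H0 /orP H1.
(* If one side were the new edge itself, [w] would be one of its ends and the other side a loop
   there; otherwise [reattach_inj] would give 0 = 1. *)
case: H0 => [/eqP/norm_edge_eqP h0|H0]; case: H1 => [/eqP/norm_edge_eqP h1|H1].
- by case: h0 h1 => [[_ ->]|[]] // [[]|[]].
- by case: h0 H1 => [[_ ->]|[]] // /(loop 1); apply.
- by case: h1 H0 => [[]|[_ ->]] // /(loop 0); apply.
- by have := reattach_inj loopless UE fn (isT : 0 < 2) (isT : 1 < 2) H0 H1.
Qed.

(** Here [g] replaces one end of the single edge; the other end becomes vertex [n], with only one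
    neighbour [a]. A triangle on the new edge would need a loop at [a]. *)
Lemma pendant_not_in_triangle g x : simple_graph g -> x \in ins_terms g edge_graph ->
  exists2 e, e \in x.2 & ~ in_triangle x.2 e.
Proof.
case: g => n E simE Hx.
have [a an [e [eE ->]]] : exists2 a, a < n & exists e,
    norm_edge e = norm_edge (a, n) /\ x = (n.+1, E ++ [:: e]).
  move: Hx => /flatten_mapP [v]; rewrite !inE => vE /mapP [f].
  have -> : count (incident v) edge_graph.2 = 1 by case/orP: vE => /eqP ->.
  move=> /[dup] /assignments_lt fn /allpairsP [[a s] /= [Ha]].
  rewrite inE => /eqP -> /= fE -> {x}; subst f.
  have an : a < n by case/andP: fn.
  exists a => //; case/orP: vE => /eqP -> /=; rewrite addnS addn1 /=.
    by exists (a, n); rewrite /shiftv /= addn0.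
  by exists (n, a); rewrite /shiftv /= addn0 norm_edgeC.
exists e; first by rewrite mem_cat inE eqxx orbT.
move=> [w]; rewrite map_cat /= !mem_cat !inE eE.
have nE k : norm_edge (k, n) \notin map norm_edge E.
  apply/mapP => [[f /(simple_lt simE) [h1 h2 _]]]; rewrite [f]surjective_pairing.
  by case/norm_edge_eqP => [] [_ nE]; move: h1 h2; rewrite -nE ltnn.
have loopE k : norm_edge (k, k) \notin map norm_edge E.
  apply/mapP => [[f /(simple_lt simE) [_ _ h]]]; rewrite [f]surjective_pairing.
  by case/norm_edge_eqP => [] [e1 e2]; move: h; rewrite -e1 -e2 eqxx.
have contra : norm_edge (n, w) \in map norm_edge E \/ norm_edge (n, w) = norm_edge (a, n) ->
   norm_edge (a, w) \in map norm_edge E \/ norm_edge (a, w) = norm_edge (a, n) -> False.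
  case; first by rewrite norm_edgeC (negbTE (nE w)).
  case/norm_edge_eqP => [] [na wn]; first by move: an; rewrite -na ltnn.
  subst w; case; first by rewrite (negbTE (loopE a)).
  by case/norm_edge_eqP => [] [aE bE]; move: an; rewrite -?aE -?bE ltnn.
move=> /orP H1 /orP H2; apply: contra.
  case/norm_edgeP/orP: eE H1 H2 => /eqP -> /= H1 H2.
    by case: H2 => [->|/eqP]; auto.
  by case: H1 => [->|/eqP]; auto.
case/norm_edgeP/orP: eE H1 H2 => /eqP -> /= H1 H2.
  by case: H1 => [->|/eqP]; auto.
by case: H2 => [->|/eqP]; auto.
Qed.

(** * The wheel coefficient *)

Section ChainTheory.
Variable R : realType.
Local Open Scope ring_scope.
Implicit Types c : chain R.

Lemma coef_chain_cat c1 c2 g : coef (c1 ++ c2) g = coef c1 g + coef c2 g.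
Proof. by rewrite /coef big_cat. Qed.

Lemma coef_chain_cons a x c g : coef ((a, x) :: c) g = (x == g)%:R * a + coef c g.
Proof.
by rewrite /coef big_cons /=; case: eqP => _; rewrite ?mul1r // mul0r add0r.
Qed.

Lemma ins_termsE g1 g2 : ins R g1 g2 = [seq (1, x) | x <- ins_terms g1 g2].
Proof.
rewrite /ins /ins_terms map_flatten -map_comp; congr flatten.
by apply: eq_map => v /=; rewrite -map_comp.
Qed.

(** The first list holds the vertex splittings, the second the pendant edges. The edge graph has one
    edge, so the bracket sign depends only on the edges of [p.2]. *)
Lemma dE c : d c = flatten [seq
  [seq (p.1, x) | x <- ins_terms edge_graph p.2] ++
  [seq (- (-1) ^+ nedges p.2 * p.1, x) | x <- ins_terms p.2 edge_graph] | p <- c].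
Proof.
rewrite /d /bracket /= cats0; congr flatten; apply: eq_map => p.
rewrite /bracket_g !ins_termsE /scalec map_cat -!map_comp mul1n.
congr (_ ++ _); apply: eq_map => x /=; first by rewrite mul1r mulr1.
by rewrite mul1r mulr1 mulrC.
Qed.

(* Since all automorphisms of the wheel are even, this is a well-defined signed
   indicator of its isomorphism class. *)
Definition wheel_sign (g : graph) : R :=
  if `[< iso_sign g heptagon_wheel false >] then 1
  else if `[< iso_sign g heptagon_wheel true >] then -1 else 0.

Lemma wheel_signE g b : iso_sign g heptagon_wheel b -> wheel_sign g = (-1) ^+ b.
Proof.
move=> H; rewrite /wheel_sign; case: asboolP => H0.
  have := wheel_automorphisms_even (iso_sign_trans (iso_sign_sym H) H0).
  by rewrite addbF => ->.
case: asboolP => H1; first by case: b H => // /H0.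
by case: b H => [/H1|/H0].
Qed.

Lemma wheel_sign0 g : (forall b, ~ iso_sign g heptagon_wheel b) -> wheel_sign g = 0.
Proof.
by move=> H; rewrite /wheel_sign; case: asboolP => [/H|_] //; case: asboolP => [/H|].
Qed.

Lemma wheel_sign_iso g g' b :
  iso_sign g g' b -> wheel_sign g' = (-1) ^+ b * wheel_sign g.
Proof.
move=> H; case: (pselect (exists b', iso_sign g heptagon_wheel b')) => [[b' Hc]|no].
  rewrite (wheel_signE Hc) (wheel_signE (iso_sign_trans (iso_sign_sym H) Hc)).
  by rewrite signr_addb.
rewrite !wheel_sign0 ?mulr0 // => b' Hc; apply: no; first by exists b'.
by exists (b (+) b'); apply: iso_sign_trans Hc.
Qed.

Definition wheel_coef c : R := \sum_(p <- c) p.1 * wheel_sign p.2.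

Lemma wheel_coef_cat c1 c2 : wheel_coef (c1 ++ c2) = wheel_coef c1 + wheel_coef c2.
Proof. by rewrite /wheel_coef big_cat. Qed.

Lemma wheel_coef_scale a c : wheel_coef (scalec a c) = a * wheel_coef c.
Proof.
rewrite /wheel_coef /scalec big_map mulr_sumr.
by apply: eq_bigr => p _; rewrite mulrA.
Qed.

(** Chains with equal coefficients may differ as lists; both sums are regrouped over one list of
    distinct graphs. *)
Lemma eq_coef_sum (f : graph -> R) c c' : (forall g, coef c g = coef c' g) ->
  \sum_(p <- c) p.1 * f p.2 = \sum_(p <- c') p.1 * f p.2.
Proof.
move=> Hcc; pose s := undup (map snd (c ++ c')).
have expand c0 : {subset map snd c0 <= s} ->
    \sum_(p <- c0) p.1 * f p.2 = \sum_(g <- s) coef c0 g * f g.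
  move=> sub; under [RHS]eq_bigr do rewrite /coef mulr_suml.
  rewrite (exchange_big_dep predT) //= !big_seq; apply: eq_bigr => p Hp.
  rewrite -big_filter (_ : [seq i <- s | _] = [:: p.2]) ?big_seq1 //.
  rewrite -(filter_pred1_uniq (undup_uniq _) (sub _ (map_f snd Hp))).
  by apply: eq_filter => g; exact: (eq_sym p.2 g).
rewrite !expand; first by apply: eq_bigr => g _; rewrite Hcc.
  by move=> g Hg; rewrite mem_undup map_cat mem_cat Hg orbT.
by move=> g Hg; rewrite mem_undup map_cat mem_cat Hg.
Qed.

(** The two terms of a relation cancel, because the sign of the isomorphism enters twice. *)
Lemma wheel_coef_gc_zero c : gc_zero c -> wheel_coef c = 0.
Proof.
move=> [rs [valid /(eq_coef_sum wheel_sign)]]; rewrite /wheel_coef => ->.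
rewrite big_flatten big_map big_seq big1 // => -[[[a g] g'] b] Hr.
have [_ /wheel_sign_iso] := valid _ Hr; rewrite !big_cons big_nil /= => ->.
by rewrite addr0 mulNr -!mulrA (mulrA ((-1) ^+ b)) -signr_addb addbb mul1r subrr.
Qed.

Lemma gc_eq_wheel_coef c1 c2 : gc_eq c1 c2 -> wheel_coef c1 = wheel_coef c2.
Proof.
move/wheel_coef_gc_zero; rewrite wheel_coef_cat wheel_coef_scale mulN1r.
by move/subr0_eq.
Qed.

Lemma wheel_coef_gamma7 : wheel_coef (gamma7 R) = 1.
Proof.
rewrite /wheel_coef /gamma7 big_cons big_seq big1 => [|p Hp].
  rewrite (wheel_signE (b := false)) ?addr0 ?mulr1 /q ?divr1 //.
  rewrite heptagon_wheelE; apply/iso_signP; split=> //; exists 1%g.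
  have := resort_refl (0, 0)%N (map norm_edge wheel_edges).
  by congr (eresort _ _ _); apply: eq_map => e; rewrite relab1.
rewrite wheel_sign0 ?mulr0 // => b /wheel_hub.
have : ~~ has (fun g : graph => has (fun v => count (incident v) g.2 == 7%N) (iota 0 g.1))
    (behead (map snd (gamma7 R))) by vm_compute.
by move=> /hasPn no; apply/negP/no; exact: (map_f snd Hp).
Qed.

Lemma wheel_coef_d c : (forall p, p \in c -> simple_graph p.2) -> wheel_coef (d c) = 0.
Proof.
move=> simc; rewrite /wheel_coef dE big_flatten big_map big_seq.
apply: big1 => -[a g] /simc /= simg; rewrite big_cat !big_map !big_seq /=.
rewrite !big1 ?addr0 // => x Hx; rewrite wheel_sign0 ?mulr0 // => b Hb.
  by have [e He []] := pendant_not_in_triangle simg Hx; apply: wheel_edge_in_triangle Hb He.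
by have [e He []] := split_not_in_triangle simg Hx; apply: wheel_edge_in_triangle Hb He.
Qed.

Lemma gamma7_not_coboundary (y : chain R) :
  (forall p, p \in y -> simple_graph p.2) -> ~ gc_eq (d y) (gamma7 R).
Proof.
move=> simy /gc_eq_wheel_coef; rewrite wheel_coef_d // wheel_coef_gamma7.
by move/esym/eqP; rewrite oner_eq0.
Qed.

Lemma gamma7_contains_wheel c :
  (forall p, p \in c -> ~ isomorphic p.2 heptagon_wheel) -> ~ gc_eq (gamma7 R) c.
Proof.
move=> noc /gc_eq_wheel_coef; rewrite wheel_coef_gamma7 /wheel_coef big_seq.
rewrite big1 => [/eqP|p Hp]; first by rewrite oner_eq0.
by rewrite wheel_sign0 ?mulr0 // => b Hb; apply: (noc p Hp); exists b.
Qed.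

End ChainTheory.

(** * Certificates for the cocycle condition *)

Fixpoint lex_lt (T : Type) (lt : rel T) (s t : seq T) : bool :=
  match s, t with
  | _, [::] => false
  | [::], _ => true
  | x :: s', y :: t' =>
      if lt x y then true else if lt y x then false else lex_lt lt s' t'
  end.

Definition nbrs (E : seq edge) (v : nat) : seq nat :=
  flatten [seq if e.1 == v then [:: e.2]
               else if e.2 == v then [:: e.1] else [::] | e <- E].

(* A vertex gets the number of vertices with a smaller key as its colour, so that
   a colouring with distinct colours is a labeling by 0, ..., n - 1. *)
Definition recolour (E : seq edge) (col : seq nat) : seq nat :=
  let keys := [seq nth 0 col v :: sort leq [seq nth 0 col u | u <- nbrs E v]
              | v <- iota 0 (size col)] in
  [seq count (fun k' => lex_lt ltn k' k) keys | k <- keys].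

(* Colour refinement with individualization of each vertex of the least repeated
   colour. Nothing is proved about it: the labelings it yields only serve as
   certificates, which [vanishes] checks. *)
Fixpoint labelings (fuel : nat) (E : seq edge) (col : seq nat) : seq (seq nat) :=
  let col := iter 3 (recolour E) col in
  if fuel is fuel'.+1 then
    if uniq col then [:: col] else
    let c := foldr minn (size col) [seq c <- col | 1 < count_mem c col] in
    flatten [seq labelings fuel' E
                [seq if (nth 0 col u == c) && (u != v) then c.+1 else nth 0 col u
                | u <- iota 0 (size col)]
            | v <- iota 0 (size col) & nth 0 col v == c]
  else [:: col].

(** The least edge list is chosen so that isomorphic graphs share it and their terms meet in
    [collect]. *)
Definition canonical_labeling (g : graph) : seq nat :=
  let ts := labelings g.1 g.2 (nseq g.1 0) in
  (foldl (fun best t => let E := (nform t g.2).2 in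
     if lex_lt lt_edge E best.2 then (t, E) else best)
    (head [::] ts, (nform (head [::] ts) g.2).2) ts).1.

(** Extracted as a closed term free of [R], on which computation can run. *)
Definition gamma7_graphs : seq graph :=
  ltac:(match eval cbv [gamma7 map snd] in (fun R => map snd (gamma7 R)) with
        | fun _ => ?l => exact l end).

(* The coefficients of [gamma7], times 16. *)
Definition gamma7_numerators : seq int :=
  [:: 16; -42; -308; -70; 98; 154; -210; 14; 70; -98; 140; -119; 98; 308;
   -98; -196; -196; -112; -112; 98; 98; -112; 112; -112; 154; -112; 196;
   -294; -42; -70; -196; 210; -98; 49; 112; -112; -77; 308; 280; -210; -112;
   -147; -308; -98; -28; -112]%Z.

(** The formula of [dE] with integer coefficients. *)
Definition dz (l : seq (int * graph)) : seq (int * graph) := flatten [seq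
  [seq (p.1, x) | x <- ins_terms edge_graph p.2] ++
  [seq ((- (-1) ^+ nedges p.2 * p.1)%R, x) | x <- ins_terms p.2 edge_graph] | p <- l].

(* Stored in normal form, so that the kernel checks the certificates without
   rerunning the search that found them. *)
Definition gamma7_labels : seq (seq nat) := Eval vm_compute in
  [seq canonical_labeling p.2 | p <- dz (zip gamma7_numerators gamma7_graphs)].

Definition normalize (ts : seq (seq nat)) (l : seq (int * graph)) :
    seq (int * seq edge) :=
  [seq let: (b, E) := nform tp.1 tp.2.2.2 in
       (if b then (- tp.2.1)%R else tp.2.1, E) | tp <- zip ts l].

(** Only adjacent equal graphs merge, hence the sort in [residue]. The initial entry there has
    coefficient 0 and leaves the total unchanged. *)
Fixpoint collect (z : int) (E : seq edge) (l : seq (int * seq edge)) :=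
  if l is (z', E') :: l' then
    if E == E' then collect (z + z')%R E l' else (z, E) :: collect z' E' l'
  else [:: (z, E)].

Definition lex_le (p q : int * seq edge) := ~~ lex_lt lt_edge q.2 p.2.

(* What remains after collecting equal graphs: it must consist of graphs with an
   odd automorphism, which are zero in the graph complex. *)
Definition residue (l : seq (int * seq edge)) : seq (int * seq edge) :=
  [seq p <- collect 0%R [::] (sort lex_le l) | p.1 != 0%R].

(** A labeling that reproduces the sorted list [E] is an automorphism; the sign [true] makes it
    odd. *)
Definition odd_automorphism (n : nat) (E : seq edge) : seq nat :=
  head [::] [seq t <- labelings n E (nseq n 0) | nform t E == (true, E)].

Definition residual_automorphisms : seq (seq nat) := Eval vm_compute in
  [seq odd_automorphism 9 p.2 | p <- residue (normalize gamma7_labels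
     (dz (zip gamma7_numerators gamma7_graphs)))].

Definition well_formed (n : nat) (E : seq edge) : bool :=
  all (fun e : edge => (e.1 < e.2) && (e.2 < n)) E && sorted lt_edge E.

Definition vanishes (n : nat) (ts : seq (seq nat)) (l : seq (int * graph))
    (auts : seq (seq nat)) : bool :=
  let l' := normalize ts l in
  let r := residue l' in
  [&& size ts == size l, all (fun t => perm_eq t (iota 0 n)) ts,
      all (fun p : int * graph => p.2.1 == n) l,
      all (fun p => well_formed n p.2) l', size auts == size r &
      all (fun tp => [&& perm_eq tp.1 (iota 0 n), well_formed n tp.2.2
          & nform tp.1 tp.2.2 == (true, tp.2.2)])
        (zip auts r)].

(** Terms of the differential have 8 + 2 - 1 = 9 vertices. *)
Lemma gamma7_vanishes :
  vanishes 9 gamma7_labels (dz (zip gamma7_numerators gamma7_graphs))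
    residual_automorphisms.
Proof. by vm_compute. Qed.

Lemma well_formed_simple n E : well_formed n E -> simple_graph (n, E).
Proof.
case/andP => /allP bounds srt; apply/andP; split.
  apply/allP => e /bounds /andP [lt12 lt2] /=.
  by rewrite (ltn_trans lt12 lt2) lt2 neq_ltn lt12.
have -> : map norm_edge E = E.
  rewrite -[RHS]map_id; apply/eq_in_map => -[a b] /bounds /andP [/= lt12 _].
  by rewrite /norm_edge /= (minn_idPl (ltnW lt12)) (maxn_idPr (ltnW lt12)).
apply: sorted_uniq srt; last by move=> e; rewrite /lt_edge !ltnn andbF.
by move=> [a b] [c d'] [e f]; rewrite /lt_edge /=; lia.
Qed.

(** * Soundness of the certificate check *)

Section Vanishing.
Variable R : realType.
Local Open Scope ring_scope.
Implicit Types c : chain R.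

Lemma eq_gc_zero c c' : (forall g, coef c g = coef c' g) -> gc_zero c -> gc_zero c'.
Proof. by move=> e [rs [v H]]; exists rs; split=> // g; rewrite -e H. Qed.

Lemma gc_zero_cat c c' : gc_zero c -> gc_zero c' -> gc_zero (c ++ c').
Proof.
move=> [rs [v H]] [rs' [v' H']]; exists (rs ++ rs'); split=> [r|g].
  by rewrite mem_cat => /orP [/v|/v'].
by rewrite map_cat flatten_cat !coef_chain_cat H H'.
Qed.

Lemma gc_zero_iso a g g' b : simple_graph g' -> iso_sign g g' b ->
  gc_zero [:: (a : R, g); (- (a * (-1) ^+ b), g')].
Proof.
(* The relation runs from [g'] to [g]: [valid_rel] wants its first graph simple, and [g'] is the one
   known to be. *)
move=> sim iso; exists [:: (- (a * (-1) ^+ b), g', g, b)]; split=> [r|h].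
  by rewrite inE => /eqP ->; split=> //; apply: iso_sign_sym.
rewrite /relvec /= !coef_chain_cons /= mulNr -mulrA -signr_addb addbb mulr1 opprK.
by rewrite addrCA.
Qed.

Lemma gc_zero_odd a g : simple_graph g -> iso_sign g g true -> gc_zero [:: (a : R, g)].
Proof.
(* An odd relation of [g] with itself reads [g + g], hence the half. *)
move=> sim iso; exists [:: (a / 2, g, g, true)]; split=> [r|h].
  by rewrite inE => /eqP ->.
rewrite /relvec /= !coef_chain_cons /= expr1 mulrN1 opprK addrA -mulrDr.
by rewrite -splitr.
Qed.

Definition sixteenths (l : seq (int * graph)) : chain R :=
  [seq (p.1%:~R / 16, p.2) | p <- l].

Lemma gamma7E : gamma7 R = sixteenths (zip gamma7_numerators gamma7_graphs).
Proof.
rewrite /gamma7 /sixteenths /=.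
(* Cross-multiplication leaves one integer identity per coefficient, settled by computation. *)
have qE a b z : (b%:R != 0 :> R) -> a * 16%:Z = z * b%:Z -> q R a b = z%:~R / 16.
  move=> b0 /(congr1 (fun x : int => x%:~R : R)); rewrite !rmorphM /= -!pmulrn => h.
  by apply/eqP; rewrite eqr_div // ?h // pnatr_eq0.
by do !congr (_ :: _); congr (_, _); apply: qE; rewrite ?pnatr_eq0.
Qed.

Lemma d_sixteenths l : d (sixteenths l) = sixteenths (dz l).
Proof.
rewrite dE /sixteenths /dz map_flatten -!map_comp; congr flatten.
apply: eq_map => p /=; rewrite map_cat -!map_comp; congr (_ ++ _).
by apply: eq_map => x /=; rewrite rmorphM rmorphN rmorphXn rmorphN1 mulrA.
Qed.

Definition on_verts (n : nat) (l : seq (int * seq edge)) : seq (int * graph) :=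
  [seq (p.1, (n, p.2)) | p <- l].

Lemma coef_collect n z E l g :
  coef (sixteenths (on_verts n (collect z E l))) g =
  coef (sixteenths (on_verts n ((z, E) :: l))) g.
Proof.
elim: l z E => [|[z' E'] l IH] z E //=.
case: eqP => [<-|_]; first by rewrite IH /= !coef_chain_cons rmorphD; lra.
by rewrite /= coef_chain_cons IH [RHS]coef_chain_cons.
Qed.

Lemma coef_residue n l g :
  coef (sixteenths (on_verts n (residue l))) g = coef (sixteenths (on_verts n l)) g.
Proof.
have drop0 l' : coef (sixteenths (on_verts n [seq p <- l' | p.1 != 0])) g =
    coef (sixteenths (on_verts n l')) g.
  elim: l' => //= -[z E] l' IH /=; rewrite coef_chain_cons -IH; case: eqP => [->|_] /=.
    by rewrite mul0r mulr0 add0r.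
  by rewrite coef_chain_cons.
rewrite drop0 coef_collect /= coef_chain_cons mul0r mulr0 add0r /coef.
by apply: perm_big; rewrite !perm_map // perm_sort.
Qed.

(** Each term differs from its normalized form by one isomorphism relation, so the difference of the
    two chains is zero in the complex. *)
Lemma gc_zero_normalize n ts (l : seq (int * graph)) :
  size ts = size l -> all (fun t => perm_eq t (iota 0 n)) ts ->
  all (fun p : int * graph => p.2.1 == n) l ->
  all (fun p => well_formed n p.2) (normalize ts l) ->
  gc_zero (sixteenths (on_verts n (normalize ts l))) -> gc_zero (sixteenths l).
Proof.
move=> sz tsn ln wf /gc_zero_cat zero.
suff [rs [valid H]] : gc_zero (sixteenths l ++
    scalec (-1) (sixteenths (on_verts n (normalize ts l)))).
  have := zero (sixteenths l ++
    scalec (-1) (sixteenths (on_verts n (normalize ts l)))).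
  case; first by exists rs.
  move=> rs' [valid' H']; exists rs'; split=> // g; rewrite -H' !coef_chain_cat.
  have -> c : coef (scalec (-1) c) g = - coef c g.
    by rewrite /coef /scalec big_map /= -sumrN; apply: eq_bigr => p _; rewrite mulN1r.
  by rewrite addrCA subrr addr0.
elim: ts l sz tsn ln wf {zero} => [|t ts IH] [|[z [n' E]] l] //=.
  by move=> *; exists [::].
move=> [sz] /andP [tn tsn] /andP [/eqP /= -> ln] /andP [wf wfs].
have := gc_zero_cat (gc_zero_iso (z%:~R / 16) (well_formed_simple _) (nform_iso E tn))
  (IH l sz tsn ln wfs).
move: wf; rewrite /normalize /=; case: (nform t E) => b E' /= wf /(_ wf).
apply: eq_gc_zero => g; rewrite /= !(coef_chain_cons, coef_chain_cat) /=.
have -> : (if b then - z else z)%:~R = z%:~R * (-1) ^+ b :> R.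
  by case: (b); rewrite ?expr1 ?mulrN1 ?rmorphN ?mulr1.
set u := coef _ g; set v := coef _ g; set x := _%:R; set y := _%:R.
by rewrite mulN1r mulrAC; ring.
Qed.

(** Normalizing preserves the class, collecting preserves all coefficients, and odd automorphisms
    kill the remaining terms one by one. *)
Lemma vanishes_gc_zero n ts l auts : vanishes n ts l auts -> gc_zero (sixteenths l).
Proof.
case/and5P => /eqP sz tsn ln wf /andP [/eqP sza check].
apply: gc_zero_normalize sz tsn ln wf _.
apply: eq_gc_zero (coef_residue n _) _.
elim: auts (residue _) sza check => [|t auts IH] [|[z E] r] //=.
  by move=> _ _; exists [::].
move=> [sz] /andP [/and3P [tn wf /eqP tE] ok].
rewrite -cat1s; apply: gc_zero_cat (IH r sz ok).
apply: gc_zero_odd; first exact: well_formed_simple.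
by have := nform_iso E tn; rewrite tE.
Qed.

End Vanishing.

Theorem theorem3p1 (R : realType) :
  (* d(gamma_7) = 0 in the non-oriented graph complex *)
  gc_zero (d (gamma7 R))
  /\
  (* gamma_7 is not a coboundary in the connected graph complex:
     it is not d of any combination of connected graphs on 7 vertices
     with 13 edges *)
  ~ (exists y : chain R,
       (forall p, p \in y ->
          [/\ nverts p.2 = 7%N, nedges p.2 = 13%N,
              simple_graph p.2 & connected_graph p.2])
       /\ gc_eq (d y) (gamma7 R))
  /\
  (* the heptagon wheel occurs in gamma_7 with nonzero coefficient:
     gamma_7 is not equal to any combination of graphs not isomorphic to
     the heptagon wheel *)
  (forall c : chain R,
     (forall p, p \in c -> ~ isomorphic p.2 heptagon_wheel) ->
     ~ gc_eq (gamma7 R) c).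
Proof.
split; first by rewrite gamma7E d_sixteenths; apply: vanishes_gc_zero gamma7_vanishes.
split; last exact: gamma7_contains_wheel.
by move=> [y [Hy]]; apply: gamma7_not_coboundary => p /Hy [].
Qed.
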